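(* Let $L_{1}$ and $L_{2}$ be finite dimensional non-nilpotent Lie superalgebras over a field $\mathbb{F}$ with $\operatorname{char}\mathbb{F}\neq 2$. If $L_{1}$ and $L_{2}$ are isomorphic as Lie superalgebras, then: (1) the nilpotent graphs $\mathfrak{G}(L_{1})$ and $\mathfrak{G}(L_{2})$ are isomorphic as graphs; (2) the non-nilpotent graphs $\mathfrak{G}(L_{1})^{c}$ and $\mathfrak{G}(L_{2})^{c}$ are isomorphic as graphs.
   Context: A Lie superalgebra over a field $\mathbb{F}$ (with $\operatorname{char}\mathbb{F}\neq 2$) is a $\mathbb{Z}_2$-graded vector space $L=L_{\overline 0}\oplus L_{\overline 1}$ with a bilinear bracket satisfying $[L_\alpha,L_\beta]\subseteq L_{\alpha+\beta}$, $[x,y]=-(-1)^{|x||y|}[y,x]$ and $[x,[y,z]]=[[x,y],z]+(-1)^{|x||y|}[y,[x,z]]$ for homogeneous $x,y,z$; if $\operatorname{char}\mathbb{F}=3$ one additionally requires $[x,[x,x]]=0$ for all $x\in L_{\overline 1}$. An isomorphism of Lie superalgebras is a bijective linear map preserving the bracket and the $\mathbb{Z}_2$-grading. ''Subalgebra'' always means $\mathbb{Z}_2$-graded subalgebra, and $\langle z,x\rangle$ denotes the subalgebra generated by $z$ and $x$, i.e. the smallest $\mathbb{Z}_2$-graded subalgebra containing $z$ and $x$ (which need not be homogeneous). A Lie superalgebra $M$ is nilpotent if $M^k=0$ for some $k\ge 1$, where $M^1=M$, $M^{k+1}=[M^k,M]$. The nilpotentizer is $\operatorname{nil}(L)=\{x\in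 L\mid \langle z,x\rangle\text{ is nilpotent for all } z\in L\}$, a possibly empty subset. For a finite dimensional non-nilpotent $L$, both the nilpotent graph $\mathfrak{G}(L)$ and the non-nilpotent graph $\mathfrak{G}(L)^c$ have vertex set $V=L\setminus(\operatorname{nil}(L)\cup\{0\})$; two distinct vertices $x,y$ are adjacent in $\mathfrak{G}(L)$ if and only if $\langle x,y\rangle$ is nilpotent, and adjacent in $\mathfrak{G}(L)^c$ if and only if $\langle x,y\rangle$ is non-nilpotent. *)

(* Defs.v *)
From HB Require Import structures.
From mathcomp Require Import all_boot all_order all_algebra.
From mathcomp Require Import boolp classical_sets.

Set Implicit Arguments.
Unset Strict Implicit.
Unset Printing Implicit Defensive.

Import GRing.Theory.
Local Open Scope classical_set_scope.
Local Open Scope ring_scope.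

(* Degrees in Z_2 are booleans, with [false] even, [true] odd and [(+)] as
   addition; the product of two degrees is their conjunction, so that
   [(-1) ^+ (a && b)] is the Koszul sign. *)
HB.mixin Record isLieSuperalgebra (F : fieldType) (L : Type)
    of GRing.Lmodule F L := {
  homog : bool -> set L;
  homog_submod : forall a, submod_closed [in homog a];
  homog_sum : forall x : L,
    exists x0 x1, [/\ homog false x0, homog true x1 & x = x0 + x1];
  homog_direct : homog false `&` homog true = [set 0];
  lieb : L -> L -> L;
  lieb_linear : forall x, linear (lieb x);
  lieb_linearl : forall y, linear (lieb^~ y);
  lieb_homog : forall a b x y,
    homog a x -> homog b y -> homog (a (+) b) (lieb x y);
  lieb_antisym : forall a b x y, homog a x -> homog b y ->
    lieb x y = - ((-1) ^+ (a && b) *: lieb y x);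
  lieb_jacobi : forall a b c x y z, homog a x -> homog b y -> homog c z ->
    lieb x (lieb y z) =
      lieb (lieb x y) z + (-1) ^+ (a && b) *: lieb y (lieb x z);
  lieb_char3 : 3%N \in [pchar F] ->
    forall x, homog true x -> lieb x (lieb x x) = 0
}.

#[short(type="lieSuperalgType")]
HB.structure Definition LieSuperalgebra (F : fieldType) :=
  { L of GRing.Lmodule F L & isLieSuperalgebra F L }.

#[short(type="finLieSuperalgType")]
HB.structure Definition FinLieSuperalgebra (F : fieldType) :=
  { L of LieSuperalgebra F L & Vector F L }.

Section LieSuperalgebraTheory.
Variables (F : fieldType) (L : lieSuperalgType F).
Implicit Types (A B : set L) (x y z : L).

Definition graded_subalgebra A : Prop :=
  [/\ submod_closed [in A],
      forall x, A x -> exists x0 x1,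
        [/\ (A `&` homog false) x0, (A `&` homog true) x1 & x = x0 + x1]
    & forall x y, A x -> A y -> A (lieb x y)].

Definition generated_subalgebra z x : set L :=
  smallest graded_subalgebra [set z; x].

Definition lie_product A B : set L :=
  smallest (fun S : set L => submod_closed [in S])
    [set lieb x y | x in A & y in B].

(* Indexed from 0: [lower_central M n] is $M^{n+1}$. *)
Definition lower_central (M : set L) (n : nat) : set L :=
  iter n (fun A => lie_product A M) M.

Definition lie_nilpotent (M : set L) : Prop :=
  exists n, lower_central M n = [set 0].

Definition nilpotentizer : set L :=
  [set x | forall z, lie_nilpotent (generated_subalgebra z x)].

End LieSuperalgebraTheory.

Arguments nilpotentizer {F} L.

Definition lie_isomorphic (F : fieldType) (L1 L2 : lieSuperalgType F) : Prop :=
  exists f : {linear L1 -> L2},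
    [/\ bijective f,
        {morph f : x y / lieb x y}
      & forall a, f @` homog a `<=` homog a].

Record graph := Graph {
  vertex : Type;
  adj : vertex -> vertex -> Prop;
  adj_sym : forall x y, adj x y -> adj y x;
  adj_irrefl : forall x, ~ adj x x
}.

Definition graph_isomorphic (G H : graph) : Prop :=
  exists f : vertex G -> vertex H,
    bijective f /\ forall x y, adj x y <-> adj (f x) (f y).

Section NilpotentGraphs.
Variables (F : fieldType) (L : finLieSuperalgType F).

Definition nil_vertices : set L := ~` (nilpotentizer L `|` [set 0]).

Implicit Types x y : nil_vertices.

Definition nil_adj x y : Prop :=
  x <> y /\ lie_nilpotent (generated_subalgebra (val x) (val y)).

Definition nonnil_adj x y : Prop :=
  x <> y /\ ~ lie_nilpotent (generated_subalgebra (val x) (val y)).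

Lemma generated_subalgebraC (u v : L) :
  generated_subalgebra u v = generated_subalgebra v u.
Proof. by rewrite /generated_subalgebra setUC. Qed.

Lemma nil_adj_sym x y : nil_adj x y -> nil_adj y x.
Proof.
by move=> [xy h]; split; [move/esym|rewrite generated_subalgebraC].
Qed.

Lemma nonnil_adj_sym x y : nonnil_adj x y -> nonnil_adj y x.
Proof.
by move=> [xy h]; split; [move/esym|rewrite generated_subalgebraC].
Qed.

Lemma nil_adj_irrefl x : ~ nil_adj x x.
Proof. by case. Qed.

Lemma nonnil_adj_irrefl x : ~ nonnil_adj x x.
Proof. by case. Qed.

Definition nilpotent_graph : graph := Graph nil_adj_sym nil_adj_irrefl.

Definition non_nilpotent_graph : graph :=
  Graph nonnil_adj_sym nonnil_adj_irrefl.

End NilpotentGraphs.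

Arguments nil_vertices {F} L _.
Arguments nilpotent_graph {F} L.
Arguments non_nilpotent_graph {F} L.

(* Main.v *)
Require Import Defs.
From HB Require Import structures.
From mathcomp Require Import all_boot all_order all_algebra.
From mathcomp Require Import boolp classical_sets.

(** Everything entering the definition of the two graphs is built from the
    linear structure, the bracket and the grading, so an isomorphism [f]
    transports it: [f] itself, restricted to the vertices, is the required
    bijection for both graphs at once.

    Two points deserve an argument. A morphism is only required to send
    homogeneous elements to homogeneous ones, so one has to check that the
    inverse of a bijective morphism respects the grading as well
    ([graded_inverse]); this follows from the directness of the grading.
    Generated subalgebras and products of subspaces are smallest sets with a
    closure property; since the images of closed sets under [f] and under its
    inverse are closed, [f] carries smallest sets to smallest sets
    ([image_smallest]). Hence [f] commutes with the lower central series and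
    with the generation of subalgebras, so that [<x, y>] is nilpotent if and
    only if [<f x, f y>] is ([lie_nilpotent_generated_iso]). As [f] is onto,
    the nilpotentizers correspond, hence so do vertices and edges. *)

Set Implicit Arguments.
Unset Strict Implicit.
Unset Printing Implicit Defensive.

Import GRing.Theory.
Local Open Scope classical_set_scope.
Local Open Scope ring_scope.

(** Each inclusion tests minimality on one side of the bijection: a [D]-set
    around [f @` G] is pulled back by [g], a [C]-set around [G] is pushed
    forward by [f]. *)
Lemma image_smallest (T U : Type) (C : set (set T)) (D : set (set U))
    (f : T -> U) (g : U -> T) (G : set T) :
  cancel f g -> cancel g f ->
  (forall A, C A -> D (f @` A)) -> (forall B, D B -> C (g @` B)) ->
  f @` smallest C G = smallest D (f @` G).
Proof.
move=> fK gK CD DC; apply/seteqP; split=> [_ [x Gx <-] B [DB GB]|y Gy].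
  have [|b Bb <-] := Gx (g @` B); last by rewrite gK.
  split; first exact: DC.
  by move=> z Gz; exists (f z); [apply: GB; exists z|].
exists (g y) => // A [CA GA].
have [|x Ax <-] := Gy (f @` A); last by rewrite fK.
by split; [exact: CD|exact: image_subset].
Qed.

Lemma image_submod (F : fieldType) (U V : lmodType F) (f : {linear U -> V})
    (A : set U) :
  submod_closed [in A] -> submod_closed [in f @` A].
Proof.
move=> [A0 Alin]; split=> [|a].
  by apply/mem_set; exists 0; [exact/set_mem|exact: linear0].
move=> _ _ /set_mem[x Ax <-] /set_mem[y Ay <-]; apply/mem_set.
exists (a *: x + y); last exact: linearP.
by apply/set_mem/Alin; exact/mem_set.
Qed.

Definition lie_morphism (F : fieldType) (L1 L2 : lieSuperalgType F)
    (f : L1 -> L2) : Prop :=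
  {morph f : x y / lieb x y} /\ forall a, f @` homog a `<=` homog a.

Lemma homog_direct_eq0 (F : fieldType) (L : lieSuperalgType F) (x : L) :
  homog false x -> homog true x -> x = 0.
Proof.
move=> x0 x1; have : (homog false `&` homog true) x by [].
by rewrite homog_direct.
Qed.

Lemma homogB (F : fieldType) (L : lieSuperalgType F) a (x y : L) :
  homog a x -> homog a y -> homog a (x - y).
Proof.
move=> hx hy; have [_ lin] := homog_submod (s := L) a.
rewrite addrC -scaleN1r; apply/set_mem/lin; exact/mem_set.
Qed.

(** Split [g x] into homogeneous parts [u0 + u1]. Then [x = f u0 + f u1] is
    the homogeneous decomposition of [x], so the part of the wrong degree has
    zero image, and vanishes because [f] is injective. *)
Lemma graded_inverse (F : fieldType) (L1 L2 : lieSuperalgType F)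
    (f : {linear L1 -> L2}) (g : L2 -> L1) :
  cancel f g -> cancel g f -> (forall a, f @` homog a `<=` homog a) ->
  forall a, g @` homog a `<=` homog a.
Proof.
move=> fK gK fgr a _ [x hx <-].
have [u0 [u1 [h0 h1 gx]]] := homog_sum (g x).
have xE : x = f u0 + f u1 by rewrite -linearD -gx gK.
have f0 : homog false (f u0) by apply: fgr; exists u0.
have f1 : homog true (f u1) by apply: fgr; exists u1.
have finj0 u : f u = 0 -> u = 0.
  by move=> fu; apply: (can_inj fK); rewrite fu linear0.
rewrite gx; case: a hx => hx.
- rewrite (finj0 u0) ?add0r //; apply: homog_direct_eq0 => //.
  by rewrite -[f u0](addrK (f u1)) -xE; exact: homogB.
- rewrite (finj0 u1) ?addr0 //; apply: homog_direct_eq0 => //.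
  by rewrite -[f u1](addKr (f u0)) -xE addrC; exact: homogB.
Qed.

Lemma lie_isomorphic_inverse (F : fieldType) (L1 L2 : lieSuperalgType F) :
  lie_isomorphic L1 L2 ->
  exists (f : {linear L1 -> L2}) (g : {linear L2 -> L1}),
    [/\ cancel f g, cancel g f, lie_morphism f & lie_morphism g].
Proof.
move=> [f [[g fK gK] fM fgr]].
pose g_linear := GRing.isLinear.Build _ _ _ _ g (can2_linear fK gK).
pose g' : {linear L2 -> L1} := HB.pack g g_linear.
exists f, g'; split => //; split; last exact: (graded_inverse fK gK fgr).
by move=> x y; apply: (can_inj fK); rewrite /= fM !gK.
Qed.

Lemma image_graded_subalgebra (F : fieldType) (L1 L2 : lieSuperalgType F)
    (f : {linear L1 -> L2}) (A : set L1) :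
  lie_morphism f -> graded_subalgebra A -> graded_subalgebra (f @` A).
Proof.
move=> [fM fgr] [Asub Agr Alie]; split; first exact: image_submod.
- move=> _ [x Ax <-]; have [x0 [x1 [[A0 h0] [A1 h1] ->]]] := Agr x Ax.
  exists (f x0), (f x1); split; last exact: linearD.
  + by split; [exists x0|apply: fgr; exists x0].
  + by split; [exists x1|apply: fgr; exists x1].
- move=> _ _ [x Ax <-] [y Ay <-].
  by exists (lieb x y); [exact: Alie|exact: fM].
Qed.

Section LieIsomorphism.
Variables (F : fieldType) (L1 L2 : lieSuperalgType F).
Variables (f : {linear L1 -> L2}) (g : {linear L2 -> L1}).
Hypotheses (fK : cancel f g) (gK : cancel g f).
Hypotheses (fM : lie_morphism f) (gM : lie_morphism g).

Lemma image_generated_subalgebra (x y : L1) :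
  f @` generated_subalgebra x y = generated_subalgebra (f x) (f y).
Proof.
rewrite /generated_subalgebra
  (image_smallest (D := @graded_subalgebra F L2) _ fK gK).
- by rewrite image_setU !image_set1.
- by move=> A; exact: image_graded_subalgebra.
- by move=> B; exact: image_graded_subalgebra.
Qed.

Lemma image_lie_product (A B : set L1) :
  f @` lie_product A B = lie_product (f @` A) (f @` B).
Proof.
rewrite /lie_product
  (image_smallest (D := fun S : set L2 => submod_closed [in S]) _ fK gK).
- congr smallest; apply/seteqP; split.
  + move=> _ [_ [x Ax [y By <-]] <-].
    exists (f x); first by exists x.
    by exists (f y); [exists y|rewrite fM.1].
  + move=> _ [_ [x Ax <-] [_ [y By <-] <-]].
    by exists (lieb x y); [exists x => //; exists y|rewrite fM.1].
- by move=> A'; exact: image_submod.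
- by move=> B'; exact: image_submod.
Qed.

Lemma image_lower_central (M : set L1) n :
  f @` lower_central M n = lower_central (f @` M) n.
Proof.
elim: n => [//|n IHn].
by rewrite /lower_central !iterS image_lie_product -/(lower_central M n) IHn.
Qed.

Lemma lie_nilpotent_image (M : set L1) :
  lie_nilpotent (f @` M) <-> lie_nilpotent M.
Proof.
have fgK A : g @` (f @` A) = A.
  by rewrite image_comp; apply: eq_image_id => x _; exact: fK.
split=> -[n Mn]; exists n; last first.
  by rewrite -image_lower_central Mn image_set1 linear0.
by rewrite -[LHS]fgK image_lower_central Mn image_set1 linear0.
Qed.

Lemma lie_nilpotent_generated_iso (x y : L1) :
  lie_nilpotent (generated_subalgebra (f x) (f y)) <->
  lie_nilpotent (generated_subalgebra x y).
Proof. by rewrite -image_generated_subalgebra; exact: lie_nilpotent_image. Qed.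

Lemma nilpotentizer_iso (x : L1) :
  nilpotentizer L2 (f x) <-> nilpotentizer L1 x.
Proof.
split=> nx z; first exact/lie_nilpotent_generated_iso/nx.
by rewrite -(gK z); apply/lie_nilpotent_generated_iso/nx.
Qed.

End LieIsomorphism.

Lemma nil_vertices_iso (F : fieldType) (L1 L2 : finLieSuperalgType F)
    (f : {linear L1 -> L2}) (g : {linear L2 -> L1}) :
  cancel f g -> cancel g f -> lie_morphism f -> lie_morphism g ->
  forall x, x \in nil_vertices L1 -> f x \in nil_vertices L2.
Proof.
move=> fK gK fM gM x /set_mem Vx; apply/mem_set => -[nfx|fx0]; apply: Vx.
  by left; exact/(nilpotentizer_iso fK gK fM gM).
by right; apply: (can_inj fK); rewrite fx0 linear0.
Qed.

Theorem proposition17 (F : fieldType) (charF : 2%N \notin [pchar F])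
    (L1 L2 : finLieSuperalgType F)
    (nnil1 : ~ lie_nilpotent [set: L1]%classic)
    (nnil2 : ~ lie_nilpotent [set: L2]%classic)
    (isoL : lie_isomorphic L1 L2) :
  graph_isomorphic (nilpotent_graph L1) (nilpotent_graph L2)
  /\ graph_isomorphic (non_nilpotent_graph L1) (non_nilpotent_graph L2).
Proof.
have [f [g [fK gK fM gM]]] := lie_isomorphic_inverse isoL.
pose fV (x : nil_vertices L1) : nil_vertices L2 :=
  exist _ (f (val x)) (nil_vertices_iso fK gK fM gM (valP x)).
pose gV (y : nil_vertices L2) : nil_vertices L1 :=
  exist _ (g (val y)) (nil_vertices_iso gK fK gM fM (valP y)).
have fVK : cancel fV gV by move=> x; apply: val_inj; exact: fK.
have gVK : cancel gV fV by move=> y; apply: val_inj; exact: gK.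
have neqV x y : x <> y <-> fV x <> fV y.
  by split=> xy; [move/(can_inj fVK)|move=> e; apply: xy; rewrite e].
have nilV (x y : nil_vertices L1) :=
  lie_nilpotent_generated_iso fK gK fM gM (val x) (val y).
split; exists fV; (split; first by exists gV) => x y; split=> -[xy nxy].
- by split; [exact/neqV|exact/nilV].
- by split; [exact/neqV|exact/nilV].
- by split; [exact/neqV|move/nilV].
- by split; [exact/neqV|move/nilV].
Qed.
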